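(* Let $\{X_\alpha\}_{\alpha\in\Gamma}$ be a family of real Banach spaces and let $1<p<\infty$. Then the $\ell_p$-sum $X=\bigoplus_{\ell_p}X_\alpha$ is nicely smooth if and only if $X_\alpha$ is nicely smooth for each $\alpha\in\Gamma$.
   Context: All Banach spaces are real. $\bigoplus_{\ell_p}X_\alpha$ is the space of all $x=(x_\alpha)_{\alpha\in\Gamma}$ with $x_\alpha\in X_\alpha$ and $\|x\|_p=(\sum_\alpha\|x_\alpha\|^p)^{1/p}<\infty$. A set $A\subseteq B(X^* )$ (closed unit ball of $X^*$) is a norming set for $X$ if $\|x\|=\sup\{x^*(x):x^*\in A\}$ for all $x\in X$. A closed subspace $F\subseteq X^*$ is a norming subspace if its closed unit ball $B(F)$ is a norming set for $X$. $X$ is nicely smooth if $X^*$ contains no proper norming (closed) subspace. *)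

(* Defs.v *)
From HB Require Import structures.
From mathcomp Require Import all_boot all_order all_algebra.
From mathcomp Require Import all_classical all_reals all_analysis.
From mathcomp Require Import ring lra.

Set Implicit Arguments.
Unset Strict Implicit.
Unset Printing Implicit Defensive.

Import Order.TTheory GRing.Theory Num.Theory.
Import numFieldNormedType.Exports.

Local Open Scope classical_set_scope.
Local Open Scope ring_scope.

Section unit_ball.
Context {R : realType} {V : normedModType R}.

Definition unit_ball (A : set V) : set V := [set x | A x /\ `|x| <= 1].

End unit_ball.

Section dual.
Context {R : realType} (X : normedModType R).

Definition dual_pred : {pred X -> R^o} :=
  mem [set f : X -> R^o | linear f /\ continuous f].

Record dual := Dual { dual_fun :> X -> R^o; dual_funP : dual_fun \in dual_pred }.

HB.instance Definition _ := [isSub for dual_fun].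
HB.instance Definition _ := [Choice of dual by <:].

Lemma dual_pred_submod_closed : submod_closed dual_pred.
Proof.
split.
  rewrite inE/=; split; last exact: cst_continuous.
  by move=> a x y; rewrite /= scaler0 addr0.
move=> a f g /[!inE]/= -[lf cf] [lg cg]; split.
  move=> b x y; rewrite !fctE lf lg.
  by rewrite !scalerDr !scalerA (mulrC a) addrACA.
move=> x; apply: cvgD; last exact: cg.
by apply: cvgZr; exact: cf.
Qed.

HB.instance Definition _ :=
  GRing.isSubmodClosed.Build _ _ dual_pred dual_pred_submod_closed.
HB.instance Definition _ := [SubChoice_isSubLmodule of dual by <:].

Lemma dual_linear (f : dual) : linear f.
Proof. by have := dual_funP f; rewrite inE => -[]. Qed.

Lemma dual_continuous (f : dual) : continuous f.
Proof. by have := dual_funP f; rewrite inE => -[]. Qed.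

HB.instance Definition _ (f : dual) :=
  GRing.isLinear.Build R X R^o *:%R f (dual_linear f).

End dual.

Arguments dual_linear {R X} f.
Arguments dual_continuous {R X} f _.

(* Locked because unification may diverge when it unfolds norms. *)
HB.lock Definition dual_norm {R : realType} {X : normedModType R}
    (f : dual X) : R :=
  sup [set `|f x| | x in unit_ball [set: X]].

Section dual_norm.
Context {R : realType} {X : normedModType R}.
Local Notation dual := (dual X).

Lemma dual_has_sup (f : dual) :
  has_sup [set `|f x| | x in unit_ball [set: X]].
Proof.
split; first by exists `|f 0|; exists 0 => //; split => //; rewrite normr0.
have /linear_bounded_continuous/bounded_funP/(_ 1)[M fM] :
    continuous (f : {linear X -> R^o}) := dual_continuous f.
by exists M => _ [x [_ x1] <-]; exact: fM.
Qed.

Lemma dual_norm_le (f : dual) (M : R) :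
  (forall x, `|x| <= 1 -> `|f x| <= M) -> dual_norm f <= M.
Proof.
move=> fM; rewrite unlock; apply: ge_sup; first by case: (dual_has_sup f).
by move=> _ [x [_ x1] <-]; exact: fM.
Qed.

Lemma dual_norm_unit (f : dual) x : `|x| <= 1 -> `|f x| <= dual_norm f.
Proof.
move=> x1; rewrite unlock; apply: sup_upper_bound; first exact: dual_has_sup.
by exists x.
Qed.

Lemma dual_norm_bound (f : dual) x : `|f x| <= dual_norm f * `|x|.
Proof.
have [->|x0] := eqVneq x 0; first by rewrite linear0 !normr0 mulr0.
have nx0 : 0 < `|x| by rewrite normr_gt0.
have := @dual_norm_unit f (`|x|^-1 *: x).
rewrite normrZ normfV normr_id mulVf ?gt_eqF// => /(_ (lexx _)).
by rewrite linearZ/= normrZ normfV normr_id mulrC ler_pdivrMr.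
Qed.

Lemma dual_norm_ge0 (f : dual) : 0 <= dual_norm f.
Proof.
by rewrite (le_trans _ (@dual_norm_unit f 0 _))// normr0.
Qed.

Lemma dual_addE (f g : dual) x : (f + g) x = f x + g x. Proof. by []. Qed.
Lemma dual_scaleE a (f : dual) x : (a *: f) x = a * f x. Proof. by []. Qed.

Lemma dual_normD (f g : dual) : dual_norm (f + g) <= dual_norm f + dual_norm g.
Proof.
apply: dual_norm_le => x x1; rewrite dual_addE (le_trans (ler_normD _ _))//.
by rewrite lerD// dual_norm_unit.
Qed.

Lemma dual_normZ a (f : dual) : dual_norm (a *: f) = `|a| * dual_norm f.
Proof.
have le b (g : dual) : dual_norm (b *: g) <= `|b| * dual_norm g.
  apply: dual_norm_le => x x1.
  by rewrite dual_scaleE normrM ler_wpM2l// dual_norm_unit.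
apply/eqP; rewrite eq_le le/=.
have [->|a0] := eqVneq a 0; first by rewrite normr0 mul0r dual_norm_ge0.
rewrite -ler_pdivlMl ?normr_gt0// -normfV (le_trans _ (le _ _))//.
by rewrite scalerA mulVf// scale1r.
Qed.

Lemma dual_norm0_eq0 (f : dual) : dual_norm f = 0 -> f = 0.
Proof.
move=> f0; apply/val_inj/funext => x /=; apply/normr0_eq0/le_anti.
by rewrite normr_ge0 andbT (le_trans (dual_norm_bound f x))// f0 mul0r.
Qed.

HB.instance Definition _ :=
  Lmodule_isNormed.Build R dual dual_normD dual_normZ dual_norm0_eq0.

Lemma dual_normE (f : dual) :
  `|f| = sup [set `|f x| | x in unit_ball [set: X]].
Proof. by rewrite -[LHS]/(dual_norm f) unlock. Qed.

End dual_norm.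

Section nicely_smooth.
Context {R : realType} (X : completeNormedModType R).

(* The supremum is taken in [\bar R], where [ereal_sup set0 = -oo], so that the
   empty set is never norming; the real-valued [sup] would return 0 on it. *)
Definition norming_set (A : set (dual X)) : Prop :=
  A `<=` unit_ball [set: dual X] /\
  forall x : X, (`|x|%:E = ereal_sup [set (f x)%:E | f in A])%E.

Definition norming_subspace (F : set (dual X)) : Prop :=
  [/\ submod_closed [in F], closed F & norming_set (unit_ball F)].

Definition nicely_smooth : Prop :=
  ~ exists F : set (dual X), norming_subspace F /\ F `<` [set: dual X].

End nicely_smooth.

Section esum_extra.
Context {R : realType} {T : choiceType}.
Local Open Scope ereal_scope.

Lemma esumZ_le (k : R) (f : T -> \bar R) : (0 <= k)%R -> (forall i, 0 <= f i) ->
  \esum_(i in [set: T]) (k%:E * f i) <= k%:E * \esum_(i in [set: T]) f i.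
Proof.
move=> k0 f0; apply: ge_ereal_sup => _ [A [finA _] <-].
rewrite -ge0_mule_fsumr//; apply: lee_wpmul2l; first by rewrite lee_fin.
by apply: esum_ge; exists A.
Qed.

End esum_extra.

(* [\esum] is the supremum of the finite subsums, so [Gamma] need not be
   countable. *)
Definition lpmass {R : realType} {Gamma : choiceType}
    {X : Gamma -> completeNormedModType R} (p : R) (x : forall a, X a) : \bar R :=
  (\esum_(a in [set: Gamma]) (`|x a| `^ p)%:E)%E.

(* The proof [p1] does not occur in the fields: it is a parameter because the
   normed space structure declared below needs it. *)
Record lpsum {R : realType} {Gamma : choiceType}
    (X : Gamma -> completeNormedModType R) {p : R} (p1 : 1 < p) := LpSum {
  lpfun :> forall a, X a ;
  lpfun_lty : (lpmass p lpfun < +oo)%E }.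

Section lpsum.
Context {R : realType} {Gamma : choiceType}.
Variables (X : Gamma -> completeNormedModType R) (p : R) (p1 : 1 < p).
Local Notation lpsum := (lpsum X p1).
Local Notation lpmass := (@lpmass R Gamma X p).
Local Notation LpSum := (@LpSum R Gamma X p p1).

HB.instance Definition _ := gen_eqMixin lpsum.
HB.instance Definition _ := gen_choiceMixin lpsum.

Lemma lpsumP (x y : lpsum) : (forall a, x a = y a) -> x = y.
Proof.
case: x y => [x xp] [y yp]/= xy.
have {}xy : x = y by exact: functional_extensionality_dep.
by subst y; f_equal; exact: Prop_irrelevance.
Qed.

Let p0 : 0 < p. Proof. exact: lt_trans p1. Qed.

Lemma lpmass_ge0 (x : forall a, X a) : (0 <= lpmass x)%E.
Proof. by apply: esum_ge0 => a _; rewrite lee_fin powR_ge0. Qed.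

Lemma lpmass0 : lpmass (fun a => 0)%R = 0%E.
Proof. by apply: esum1 => a _; rewrite normr0 powR0// gt_eqF. Qed.

Lemma lpmassZ_le k (x : forall a, X a) :
  (lpmass (fun a => k *: x a) <= (`|k| `^ p)%:E * lpmass x)%E.
Proof.
apply: le_trans (esumZ_le (powR_ge0 _ _) _); last first.
  by move=> a; rewrite lee_fin powR_ge0.
by apply: le_esum => a _; rewrite normrZ powRM.
Qed.

Lemma powR_convex2 (s t u v : R) : 0 < s -> 0 < t -> 0 <= u -> 0 <= v ->
  (u + v) `^ p <= (s + t) `^ p *
    (s / (s + t) * (u / s) `^ p + t / (s + t) * (v / t) `^ p).
Proof.
move=> s0 t0 u0 v0; have st0 : 0 < s + t by rewrite addr_gt0.
have l01 : 0 <= s / (s + t) <= 1.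
  rewrite ler_pdivrMr// mul1r lerDl (ltW t0) andbT.
  by rewrite divr_ge0// ltW.
have /andP[l0 l1] := l01.
have lE : 1 - s / (s + t) = t / (s + t) by field; rewrite gt_eqF.
have us0 : 0 <= u / s by rewrite divr_ge0// ltW.
have vt0 : 0 <= v / t by rewrite divr_ge0// ltW.
have := @convex_powR R p (ltW p1) (Itv01 l0 l1) (u / s) (v / t).
rewrite !inE/= !in_itv/= !andbT => /(_ us0 vt0).
rewrite convRE [X in X `^ _ <= _ -> _]convRE/= /unstable.onem lE => H.
have -> : u + v = (s + t) * (s / (s + t) * (u / s) + t / (s + t) * (v / t)).
  by field; rewrite !gt_eqF.
rewrite powRM ?(ltW st0) ?ler_wpM2l ?powR_ge0//.
by rewrite addr_ge0// mulr_ge0// -lE subr_ge0.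
Qed.

Lemma lpmassD_le (s t : R) (x y : forall a, X a) : 0 < s -> 0 < t ->
  (lpmass (fun a => x a + y a)%R
   <= ((s + t) `^ p * (s / (s + t) * s^-1 `^ p))%:E * lpmass x
    + ((s + t) `^ p * (t / (s + t) * t^-1 `^ p))%:E * lpmass y)%E.
Proof.
move=> s0 t0.
have st0 : 0 < s + t by rewrite addr_gt0.
set c := (X in (X%:E * lpmass x)%E); set d := (X in (X%:E * lpmass y)%E).
have c0 : 0 <= c.
  by rewrite !mulr_ge0 ?powR_ge0 ?ltW// invr_gt0.
have d0 : 0 <= d.
  by rewrite !mulr_ge0 ?powR_ge0 ?ltW// invr_gt0.
have xp0 (z : forall a, X a) a : (0 <= (`|z a| `^ p)%:E)%E.
  by rewrite lee_fin powR_ge0.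
rewrite (le_trans _ (leeD (esumZ_le c0 (xp0 x)) (esumZ_le d0 (xp0 y))))//.
rewrite -esumD; [|by move=> a _; exact: mule_ge0..].
apply: le_esum => a _; rewrite -!EFinM -EFinD lee_fin.
rewrite (@le_trans _ _ ((`|x a| + `|y a|) `^ p))//.
  by rewrite ge0_ler_powR ?nnegrE ?addr_ge0 ?ler_normD// ltW.
rewrite (le_trans (powR_convex2 s0 t0 _ _))//.
rewrite !powRM ?invr_ge0 ?(ltW s0) ?(ltW t0)// /c /d.
by rewrite le_eqVlt; apply/orP; left; apply/eqP; ring.
Qed.

Lemma lpsum0_subproof : (lpmass (fun a => 0 : X a)%R < +oo)%E.
Proof. by rewrite lpmass0 ltry. Qed.

Lemma lpsumZ_subproof k (x : lpsum) :
  (lpmass (fun a => k *: x a) < +oo)%E.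
Proof.
by rewrite (le_lt_trans (lpmassZ_le _ _))// lte_mul_pinfty ?lpfun_lty.
Qed.

Lemma lpsumN_subproof (x : lpsum) : (lpmass (fun a => - x a)%R < +oo)%E.
Proof.
rewrite (_ : lpmass _ = lpmass (lpfun x)) ?lpfun_lty//.
by apply: eq_esum => a _; rewrite normrN.
Qed.

Lemma lpsumD_subproof (x y : lpsum) : (lpmass (fun a => x a + y a)%R < +oo)%E.
Proof.
rewrite (le_lt_trans (lpmassD_le _ _ ltr01 ltr01))//.
by rewrite lte_add_pinfty// lte_mul_pinfty// ?lpfun_lty// lee_fin
  !mulr_ge0// ?powR_ge0.
Qed.

Definition lpsum_zero := LpSum lpsum0_subproof.
Definition lpsum_opp x := LpSum (lpsumN_subproof x).
Definition lpsum_add x y := LpSum (lpsumD_subproof x y).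
Definition lpsum_scale k x := LpSum (lpsumZ_subproof k x).

Lemma lpsum_addA : associative lpsum_add.
Proof. by move=> x y z; apply: lpsumP => a /=; rewrite addrA. Qed.
Lemma lpsum_addC : commutative lpsum_add.
Proof. by move=> x y; apply: lpsumP => a /=; rewrite addrC. Qed.
Lemma lpsum_add0 : left_id lpsum_zero lpsum_add.
Proof. by move=> x; apply: lpsumP => a /=; rewrite add0r. Qed.
Lemma lpsum_addN : left_inverse lpsum_zero lpsum_opp lpsum_add.
Proof. by move=> x; apply: lpsumP => a /=; rewrite addNr. Qed.

HB.instance Definition _ := GRing.isZmodule.Build lpsum
  lpsum_addA lpsum_addC lpsum_add0 lpsum_addN.

Lemma lpsum_scaleA a b x :
  lpsum_scale a (lpsum_scale b x) = lpsum_scale (a * b) x.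
Proof. by apply: lpsumP => i /=; rewrite scalerA. Qed.
Lemma lpsum_scale1 : left_id 1 lpsum_scale.
Proof. by move=> x; apply: lpsumP => i /=; rewrite scale1r. Qed.
Lemma lpsum_scaleDr : right_distributive lpsum_scale +%R.
Proof. by move=> k x y; apply: lpsumP => i /=; rewrite scalerDr. Qed.
Lemma lpsum_scaleDl x :
  {morph lpsum_scale^~ x : a b / a + b >-> a + b}.
Proof. by move=> a b; apply: lpsumP => i /=; rewrite scalerDl. Qed.

HB.instance Definition _ := GRing.Zmodule_isLmodule.Build R lpsum
  lpsum_scaleA lpsum_scale1 lpsum_scaleDr lpsum_scaleDl.

End lpsum.

HB.lock Definition lpnorm {R : realType} {Gamma : choiceType}
    {X : Gamma -> completeNormedModType R} {p : R} {p1 : 1 < p}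
    (x : lpsum X p1) : R :=
  fine (lpmass p x) `^ p^-1.

Section lpsum_norm.
Context {R : realType} {Gamma : choiceType}.
Context {X : Gamma -> completeNormedModType R} {p : R} {p1 : 1 < p}.
Local Notation lpsum := (lpsum X p1).
Local Notation lpmass := (@lpmass R Gamma X p).

Let p0 : 0 < p. Proof. exact: lt_trans p1. Qed.

Lemma lpnorm_ge0 (x : lpsum) : 0 <= lpnorm x. Proof. by rewrite unlock powR_ge0. Qed.

Lemma lpmassE (x : lpsum) : lpmass x = (lpnorm x `^ p)%:E.
Proof.
rewrite unlock -powRrM mulVf ?gt_eqF// powRr1 ?fine_ge0 ?lpmass_ge0//.
by rewrite fineK// ge0_fin_numE ?lpmass_ge0// lpfun_lty.
Qed.

Lemma lpnorm_le (x : lpsum) (c : R) : 0 <= c ->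
  (lpnorm x <= c) = (lpmass x <= (c `^ p)%:E)%E.
Proof.
move=> c0; rewrite lpmassE lee_fin; apply/idP/idP => [xc|].
  by rewrite ge0_ler_powR ?nnegrE ?lpnorm_ge0// ltW.
by apply: contraTT; rewrite -!ltNge => cx; rewrite gt0_ltr_powR ?nnegrE ?lpnorm_ge0.
Qed.

Lemma lpnorm_coord (x : lpsum) a : `|x a| <= lpnorm x.
Proof.
have : ((`|x a| `^ p)%:E <= lpmass x)%E.
  apply: esum_ge; exists [set a]; first by split.
  by rewrite fsbig_set1.
rewrite lpmassE lee_fin; apply: contraTT; rewrite -!ltNge => cx.
by rewrite gt0_ltr_powR ?nnegrE ?lpnorm_ge0.
Qed.

Lemma lpnorm0_eq0 (x : lpsum) : lpnorm x = 0 -> x = 0.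
Proof.
move=> x0; apply: lpsumP => a; apply/normr0_eq0/le_anti.
by rewrite normr_ge0 andbT (le_trans (lpnorm_coord x a))// x0.
Qed.

Lemma lpnormZ k (x : lpsum) : lpnorm (k *: x) = `|k| * lpnorm x.
Proof.
have le c (z : lpsum) : lpnorm (c *: z) <= `|c| * lpnorm z.
  rewrite lpnorm_le ?mulr_ge0 ?lpnorm_ge0// (le_trans (lpmassZ_le _ _ _))//.
  by rewrite lpmassE -EFinM powRM ?lpnorm_ge0.
apply/eqP; rewrite eq_le le/=.
have [->|k0] := eqVneq k 0; first by rewrite normr0 mul0r lpnorm_ge0.
have nk0 : 0 < `|k| by rewrite normr_gt0.
have := le k^-1 (k *: x); rewrite scalerA mulVf// scale1r.
by rewrite normfV (ler_pdivlMl _ _ nk0).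
Qed.

Lemma lpnormD (x y : lpsum) : lpnorm (x + y) <= lpnorm x + lpnorm y.
Proof.
have [/lpnorm0_eq0 ->|x0] := eqVneq (lpnorm x) 0.
  by rewrite add0r lerDr lpnorm_ge0.
have [/lpnorm0_eq0 ->|y0] := eqVneq (lpnorm y) 0.
  by rewrite addr0 lerDl lpnorm_ge0.
have {}x0 : 0 < lpnorm x by rewrite lt0r x0 lpnorm_ge0.
have {}y0 : 0 < lpnorm y by rewrite lt0r y0 lpnorm_ge0.
rewrite lpnorm_le; last by rewrite addr_ge0 ?lpnorm_ge0.
apply: le_trans (@lpmassD_le _ _ _ _ p1 _ _ x y x0 y0) _.
rewrite (lpmassE x) (lpmassE y).
move: (lpnorm x) (lpnorm y) x0 y0 => {x y} s t s0 t0.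
rewrite -!EFinM -EFinD lee_fin.
have K (u : R) : 0 < u -> u^-1 `^ p * u `^ p = 1.
  by move=> u0; rewrite -powRM ?invr_ge0 ?ltW// mulVf ?gt_eqF// powR1.
rewrite -!mulrA (K _ s0) (K _ t0) !mulr1 -mulrDr -mulrDl mulfV ?mulr1//.
by rewrite gt_eqF// addr_gt0.
Qed.

HB.instance Definition _ :=
  Lmodule_isNormed.Build R lpsum lpnormD lpnormZ lpnorm0_eq0.

Lemma lpsum_normE (x : lpsum) :
  `|x| = fine (\esum_(a in [set: Gamma]) (`|x a| `^ p)%:E) `^ p^-1.
Proof. by rewrite -[LHS]/(lpnorm x) unlock. Qed.

Lemma lpsum_cauchy (F : set_system lpsum) : ProperFilter F -> cauchy F ->
  forall e, 0 < e -> exists2 A, F A & forall x y : lpsum, A x -> A y ->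
    `|x - y| < e.
Proof.
move=> FF /cauchyP Fc e e0.
have [x0 Fx0] := Fc (e / 2) (divr_gt0 e0 (ltr0Sn _ 1)).
exists (ball x0 (e / 2)) => // x y; rewrite -ball_normE/= => x0x x0y.
rewrite (_ : x - y = (x0 - y) - (x0 - x)).
  by rewrite (le_lt_trans (ler_normB _ _))// (splitr e) ltrD.
by rewrite opprB [RHS]addrC addrA subrK.
Qed.

Lemma cvg_powR (T : Type) (F : set_system T) (g : T -> R) (u : R) :
  Filter F -> (forall y, 0 <= g y) -> g y @[y --> F] --> u ->
  g y `^ p @[y --> F] --> u `^ p.
Proof.
move=> FF g0 gu; have [u0|u0|u0] := ltgtP u 0.
- have : \forall y \near F, g y < 0 by exact: cvgr_lt gu _ u0.
  move=> Fn; apply: cvg_near_cst; apply: filterS Fn => y.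
  by rewrite ltNge g0.
- apply: (@cvg_comp _ _ _ g (@powR R ^~ p)); first exact: gu.
  have dp : derivable (@powR R ^~ p) u 1.
    by apply: derivable_powR; rewrite in_itv/= u0.
  by move/derivable1_diffP : dp => /differentiable_continuous.
- rewrite u0 powR0 ?gt_eqF//; apply/cvgrPdist_le => e e0.
  have e'0 : 0 < e `^ p^-1 by rewrite powR_gt0.
  have : \forall y \near F, g y <= e `^ p^-1.
    by apply: cvgr_le gu _ _; rewrite u0.
  apply: filterS => y gy.
  rewrite sub0r normrN ger0_norm ?powR_ge0//.
  rewrite -[leRHS]powRr1 ?(ltW e0)// -(@mulVf _ p) ?gt_eqF// powRrM.
  by rewrite ge0_ler_powR ?nnegrE ?powR_ge0// ltW.
Qed.

Lemma lpsum_coord_cvg (F : set_system lpsum) (l : forall a, X a) :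
  ProperFilter F -> cauchy F ->
  (forall a, (x : lpsum) a @[x --> F] --> l a) ->
  forall e, 0 < e -> \forall x \near F,
    (lpmass (fun a => (x : lpsum) a - l a)%R <= (e `^ p)%:E)%E.
Proof.
move=> FF Fc Fl e e0.
have [A FA Ae] := lpsum_cauchy FF Fc e0.
apply: (filterS _ FA) => x Ax.
apply: ge_ereal_sup => _ [J [finJ _] <-].
rewrite fsumEFin// lee_fin.
have cvgJ : (\sum_(a \in J) `|x a - (y : lpsum) a| `^ p) @[y --> F] -->
    \sum_(a \in J) `|x a - l a| `^ p.
  under eq_fun do rewrite fsbig_finite//=.
  rewrite fsbig_finite//=; apply: cvg_big => [|a _]; first exact: add_continuous.
  apply: cvg_powR => //.
  by apply: cvg_norm; apply: cvgB; [exact: cvg_cst|exact: Fl].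
apply: (cvgr_to_le cvgJ); apply: (filterS _ FA) => y Ay.
have := Ae x y Ax Ay => /ltW; rewrite -[`|_|]/(lpnorm _) lpnorm_le ?(ltW e0)//.
rewrite -lee_fin -fsumEFin//; apply: le_trans.
by apply: esum_ge; exists J.
Qed.

Lemma lpsum_complete (F : set_system lpsum) :
  ProperFilter F -> cauchy F -> cvg F.
Proof.
move=> FF Fc.
have Fcvg a : cvg ((x : lpsum) a @[x --> F]).
  apply: cauchy_cvg; apply/cauchyP => e e0.
  have [A FA Ae] := lpsum_cauchy FF Fc e0.
  have [x Ax] := filter_ex FA.
  exists (x a); suff: \forall y \near F, ball (x a) e ((y : lpsum) a) by [].
  apply: (filterS _ FA) => y Ay.
  rewrite -ball_normE/=; apply: le_lt_trans (Ae x y Ax Ay).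
  exact: (lpnorm_coord (x - y)).
have Fl := lpsum_coord_cvg FF Fc Fcvg.
have [x xl] := filter_ex (Fl 1 ltr01).
have xlP : (lpmass (fun a => x a - lim ((x : lpsum) a @[x --> F]))%R < +oo)%E.
  by rewrite (le_lt_trans xl)// ltry.
pose l := x - @LpSum _ _ _ _ p1 _ xlP; apply/cvg_ex; exists l.
apply/cvgrPdist_le => e e0; apply: filterS (Fl e e0) => y ye.
rewrite distrC -[`|_|]/(lpnorm _) lpnorm_le ?(ltW e0)//.
rewrite (_ : lpmass _ =
  lpmass (fun a => y a - lim ((x : lpsum) a @[x --> F]))%R)//.
by apply: eq_esum => a _; rewrite /= subKr.
Qed.

HB.instance Definition _ := Uniform_isComplete.Build lpsum lpsum_complete.

End lpsum_norm.

(* Main.v *)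
Require Import Defs.
From HB Require Import structures.
From mathcomp Require Import all_boot all_order all_algebra.
From mathcomp Require Import all_classical all_reals all_analysis.
From mathcomp Require Import lra.

Set Implicit Arguments.
Unset Strict Implicit.
Unset Printing Implicit Defensive.

Import Order.TTheory GRing.Theory Num.Theory.
Import numFieldNormedType.Exports.

(** Write [inj a] and [proj a] for the embedding of the summand [X a] and for
    the projection onto it; both are contractions and so are their adjoints.

    If [F] is a proper norming subspace of the dual of [X a], the functionals on
    the sum whose restriction to [X a] lies in [F] form a proper closed
    subspace, and it is norming ([norming_subspace_inj]): a functional attaining
    the norm of a given vector (Hahn-Banach) can have its coordinate at [a]
    replaced by an element of [F] without increasing its norm and almost without
    changing its value.

    Conversely let [G] be a proper norming subspace of the dual of the sum.  By
    Hahn-Banach there is a nonzero [psi] in the bidual vanishing on [G]; its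
    coordinates are the [adjoint (adjoint (proj a)) psi].  Here [1 < p] matters,
    through the following fact ([almost_norming_small]): a functional of norm at
    most 1 that almost attains its norm at a unit vector supported in [A] is
    small on vectors supported off [A], because adding [s *: v] with [v] off [A]
    increases the norm by at most [s `^ p], which is negligible against [s].
    It is used twice.

    - The kernel of each coordinate of [psi] is norming
      ([norming_subspace_kernel]), so that coordinate is zero when [X a] is
      nicely smooth.  The kernel of a single [psi] is considered, rather than
      all the [f] such that [adjoint (proj a) f] is in [G], because the fact
      above only makes [adjoint (proj a) f] close to [G] for many [f]; that
      makes the coordinate of [psi] small at [f], which a small multiple of a
      fixed functional corrects.

    - A [psi] whose coordinates all vanish is zero ([coordinates_total]):
      every functional almost attains its norm at a finitely supported vector,
      hence is close to a finite sum of coordinate functionals.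

    The Hahn-Banach theorem is proved for sublinear functionals: minimal ones
    are linear, and exist by Zorn's lemma. *)

Local Open Scope classical_set_scope.
Local Open Scope ring_scope.

(** * The Hahn-Banach theorem *)

Section hahn_banach.
Context {R : realType} {V : lmodType R}.
Implicit Types (q m : V -> R) (x y : V).

(** The inequality for positive [a] forces the equality, and [q 0 = 0]: see
    [sublinear0] and [sublinearZ]. *)
Definition sublinear q : Prop :=
  (forall x y, q (x + y) <= q x + q y) /\
  (forall (a : R) x, 0 < a -> q (a *: x) <= a * q x).

Lemma sublinear0 q : sublinear q -> q 0 = 0.
Proof.
case=> _ qZ; have := qZ 2 0 (ltr0Sn R 1); have := qZ 2^-1 0.
by rewrite !scaler0 invr_gt0 ltr0n => /(_ isT); lra.
Qed.

Lemma sublinearZ q a x : sublinear q -> 0 <= a -> q (a *: x) = a * q x.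
Proof.
move=> qs; rewrite le_eqVlt => /predU1P[<-|a0].
  by rewrite scale0r mul0r sublinear0.
apply/eqP; rewrite eq_le qs.2//= -ler_pdivlMl//.
rewrite -[x in q x <= _](scalerK (lt0r_neq0 a0)).
by apply: qs.2; rewrite invr_gt0.
Qed.

Lemma sublinear_ge q x : sublinear q -> - q (- x) <= q x.
Proof.
move=> qs; have := qs.1 x (- x); rewrite subrr sublinear0//.
by rewrite -lerBlDr sub0r.
Qed.

(** Sublinearity of a pointwise infimum only asks that each inequality be
    witnessed by some member of the family, which may depend on the points. *)
Lemma sublinear_inf (Q : set (V -> R)) : Q !=set0 ->
  (forall x, has_lbound [set m x | m in Q]) ->
  (forall m n x y, Q m -> Q n -> exists2 k, Q k & k (x + y) <= m x + n y) ->
  (forall m (a : R) x, Q m -> 0 < a ->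
    exists2 k, Q k & k (a *: x) <= a * m x) ->
  sublinear (fun x => inf [set m x | m in Q]).
Proof.
move=> [m0 Qm0] Qlb QD QZ.
have inf_greatest x c : (forall m, Q m -> c <= m x) ->
    c <= inf [set m x | m in Q].
  move=> cQ; apply: lb_le_inf; first by exists (m0 x), m0.
  by move=> _ [m Qm <-]; exact: cQ.
have inf_lower x m : Q m -> inf [set m x | m in Q] <= m x.
  by move=> Qm; apply: ge_inf => //; exists m.
split=> [x y|a x a0].
  rewrite -lerBlDr; apply: (inf_greatest) => m Qm; rewrite lerBlDr -lerBlDl.
  apply: (inf_greatest) => n Qn; rewrite lerBlDl.
  by have [k Qk] := QD m n x y Qm Qn; apply: le_trans; exact: inf_lower.
rewrite -ler_pdivrMl//; apply: (inf_greatest) => m Qm; rewrite ler_pdivrMl//.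
by have [k Qk] := QZ m a x Qm a0; apply: le_trans; exact: inf_lower.
Qed.

(** This is the largest sublinear functional below [q] whose value at [- y] is
    at most [- q y]: the price of making [q] linear along [y]. *)
Definition straighten q y x : R :=
  inf [set m x | m in [set (fun z => q (z + t *: y) - t * q y) | t in
    [set t : R | 0 <= t]]].

Section straighten.
Variables (q : V -> R) (y : V).
Hypothesis qs : sublinear q.

Let straighten_lb x : has_lbound [set m x | m in
  [set (fun z => q (z + t *: y) - t * q y) | t in [set t : R | 0 <= t]]].
Proof.
exists (- q (- x)) => _ [_ [t t0 <-] <-].
have := qs.1 (x + t *: y) (- x).
by rewrite addrAC subrr add0r sublinearZ//; lra.
Qed.

Let straighten_ub x (t : R) :
  0 <= t -> straighten q y x <= q (x + t *: y) - t * q y.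
Proof.
move=> t0; apply: ge_inf; first exact: straighten_lb.
by exists (fun z => q (z + t *: y) - t * q y) => //; exists t.
Qed.

Lemma straighten_le x : straighten q y x <= q x.
Proof.
by have := straighten_ub x (lexx 0); rewrite scale0r addr0 mul0r subr0.
Qed.

Lemma straightenN : straighten q y (- y) <= - q y.
Proof.
have := straighten_ub (- y) ler01.
by rewrite scale1r addNr sublinear0// mul1r sub0r.
Qed.

Lemma straighten_sublinear : sublinear (straighten q y).
Proof.
apply: sublinear_inf => //.
- by exists (fun z => q (z + 0 *: y) - 0 * q y); exists 0 => //=.
- move=> _ _ u v [s s0 <-] [t t0 <-].
  exists (fun z => q (z + (s + t) *: y) - (s + t) * q y).
    by exists (s + t) => //=; rewrite addr_ge0.
  have -> : u + v + (s + t) *: y = (u + s *: y) + (v + t *: y).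
    by rewrite scalerDl addrACA.
  by rewrite mulrDl opprD [leRHS]addrACA lerD2r; exact: qs.1.
- move=> _ a u [t t0 <-] a0.
  exists (fun z => q (z + (a * t) *: y) - (a * t) * q y).
    by exists (a * t) => //=; rewrite mulr_ge0// ltW.
  by rewrite -scalerA -scalerDr sublinearZ ?(ltW a0)//= mulrBr mulrA.
Qed.

End straighten.

(** A lower bound of a chain of sublinear functionals is its pointwise infimum,
    so Zorn's lemma applies to the sublinear functionals below [q]. *)
Lemma minimal_sublinear q : sublinear q -> exists m,
  [/\ sublinear m, forall x, m x <= q x &
    forall n, sublinear n -> (forall x, n x <= m x) -> n = m].
Proof.
move=> qs; pose P m := sublinear m /\ forall x, m x <= q x.
pose T := {m : V -> R | P m}.
pose below (m n : T) := `[< forall x, sval n x <= sval m x >].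
have chain_lb (A : set T) : total_on A below ->
    exists t, forall s, A s -> below s t.
  move=> Atot; have [A0|/set0P[s0 As0]] := eqVneq A set0.
    have qq : P q by [].
    by exists (exist P q qq) => s; rewrite A0.
  pose Q := sval @` A.
  have Q0 : Q !=set0 by exists (sval s0), s0.
  have Qlb x : has_lbound [set m x | m in Q].
    exists (- q (- x)) => _ [_ [[m [ms mq]] _ <-] <-] /=.
    by apply: le_trans (sublinear_ge x ms); rewrite lerN2.
  have infQ x s : A s -> inf [set m x | m in Q] <= sval s x.
    by move=> As; apply: ge_inf => //; exists (sval s) => //; exists s.
  have Qs : sublinear (fun x => inf [set m x | m in Q]).
    apply: sublinear_inf => //.
      move=> _ _ x y [r Ar <-] [s As <-].
      have [/asboolP rs|/asboolP sr] := Atot _ _ Ar As.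
        exists (sval s); first by exists s.
        by apply: le_trans ((svalP s).1.1 x y) _; rewrite lerD2r.
      exists (sval r); first by exists r.
      by apply: le_trans ((svalP r).1.1 x y) _; rewrite lerD2l.
    move=> _ a x [r Ar <-] a0; exists (sval r); first by exists r.
    exact: (svalP r).1.2.
  have Qq x : inf [set m x | m in Q] <= q x.
    by apply: le_trans (infQ x _ As0) _; exact: (svalP s0).2.
  by exists (exist P _ (conj Qs Qq)) => s As; apply/asboolP => x; exact: infQ.
have [||||[m [ms mq]] mmin] := @Zorn T below.
- by move=> t; exact/asboolP.
- move=> r s t /asboolP rs /asboolP st; apply/asboolP => x.
  exact: le_trans (st x) (rs x).
- move=> [m mP] [n nP] /asboolP /= nm /asboolP /= mn; apply: eq_exist.
  by apply/funext => x; apply/le_anti; rewrite nm mn.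
- exact: chain_lb.
exists m; split=> // n ns nm.
have nq x : n x <= q x by exact: le_trans (nm x) (mq x).
by have /(congr1 sval) := mmin (exist P n (conj ns nq)) (introT (asboolP _) nm).
Qed.

(** Straightening a minimal functional along any vector changes nothing, which
    makes it odd, hence linear.  To touch [q] at [y], start from the
    straightening of [q] along [y]. *)
Theorem hahn_banach q y : sublinear q -> exists f : V -> R^o,
  [/\ linear f, forall x, f x <= q x & f y = q y].
Proof.
move=> qs; have [f [fs fq fmin]] :=
  minimal_sublinear (straighten_sublinear y qs).
have fle x : f x <= q x := le_trans (fq x) (straighten_le y qs x).
have fN x : f (- x) = - f x.
  have := straightenN x fs.
  rewrite (fmin _ (straighten_sublinear x fs) (straighten_le x fs)).
  by have := sublinear_ge x fs; lra.
have fD x z : f (x + z) = f x + f z.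
  have := fs.1 x z; have := fs.1 (- x) (- z).
  by rewrite -opprD !fN; lra.
have fZ a x : f (a *: x) = a * f x.
  have [a0|a0] := leP 0 a; first exact: sublinearZ.
  rewrite -[a]opprK scaleNr fN sublinearZ ?mulNr// oppr_ge0.
  exact: ltW.
exists f; split => //.
  by move=> a x z; rewrite fD fZ.
apply/le_anti; rewrite fle/= -lerN2 -fN.
exact: le_trans (fq _) (straightenN y qs).
Qed.

End hahn_banach.

(** * Functionals and contractions between normed spaces *)

Section submodules.
Context {R : realType}.

Lemma submod_closedP (V : lmodType R) (F : set V) : submod_closed [in F] <->
  F 0 /\ forall (k : R) u v, F u -> F v -> F (k *: u + v).
Proof.
split=> [[F0 Flin]|[F0 Flin]].
  split; first by move: F0; rewrite inE.
  by move=> k u v Fu Fv; have := Flin k u v; rewrite !inE; apply.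
by split=> [|k u v]; rewrite !inE//; exact: Flin.
Qed.

Lemma submod_closedZ (V : lmodType R) (F : set V) (k : R) u :
  submod_closed [in F] -> F u -> F (k *: u).
Proof.
by move=> /submod_closedP[F0 Flin] Fu; rewrite -[_ *: _]addr0; exact: Flin.
Qed.

Lemma submod_closed_preimage (U V : lmodType R) (T : {linear U -> V})
    (F : set V) : submod_closed [in F] -> submod_closed [in T @^-1` F].
Proof.
move=> /submod_closedP[F0 Flin]; apply/submod_closedP; split.
  by rewrite /preimage/= linear0.
by move=> k u v Fu Fv; rewrite /preimage/= linearP; exact: Flin.
Qed.

End submodules.

Section continuity.
Context {R : realType} {X Y : normedModType R}.

Lemma linear_le_continuous (f : X -> Y) (C : R) : linear f ->
  (forall x, `|f x| <= C * `|x|) -> continuous f.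
Proof.
move=> lf fC.
pose L : {linear X -> Y} := HB.pack f (GRing.isLinear.Build R X Y *:%R f lf).
apply/(linear_bounded_continuous L)/bounded_funP => r.
exists (`|C| * r) => x xr; apply: le_trans (fC x) _.
apply: le_trans (ler_wpM2l (normr_ge0 C) xr).
by rewrite ler_wpM2r// ler_norm.
Qed.

End continuity.

Section functionals.
Context {R : realType} {X : normedModType R}.
Implicit Types (f : dual X) (x : X).

Lemma dualD f x y : f (x + y) = f x + f y. Proof. exact: linearD. Qed.
Lemma dualB f x y : f (x - y) = f x - f y. Proof. exact: linearB. Qed.
Lemma dualZ f (k : R) x : f (k *: x) = k * f x. Proof. exact: linearZ. Qed.

Lemma dual_norm_apply f x : `|f x| <= `|f| * `|x|.
Proof. exact: dual_norm_bound. Qed.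

Lemma dual_apply_le f x : f x <= `|f| * `|x|.
Proof. exact: le_trans (ler_norm _) (dual_norm_apply f x). Qed.

Lemma dual_ballP f : `|f| <= 1 <-> forall x, f x <= `|x|.
Proof.
split=> [f1 x|fx].
  by apply: le_trans (dual_apply_le f x) _; rewrite ler_piMl.
apply: dual_norm_le => x x1; rewrite ler_norml.
rewrite (le_trans (fx x) x1) andbT lerNl -linearN.
by apply: le_trans (fx (- x)) _; rewrite normrN.
Qed.

Lemma dual_norm_leP f (M : R) : 0 <= M ->
  `|f| <= M <-> forall x, `|f x| <= M * `|x|.
Proof.
move=> M0; split=> [fM x|fM].
  by apply: le_trans (dual_norm_apply f x) _; rewrite ler_wpM2r.
by apply: dual_norm_le => x x1; apply: le_trans (fM x) _; rewrite ler_piMr.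
Qed.

Lemma dual_norm_adherent f (e : R) : 0 < e ->
  exists2 x : X, `|x| <= 1 & `|f| - e < f x.
Proof.
move=> e0; have [_ [x [_ x1] <-]] := sup_adherent e0 (dual_has_sup f).
rewrite -dual_normE => fx.
have [fx0|fx0] := leP 0 (f x).
  by exists x => //; rewrite -(ger0_norm fx0).
by exists (- x); rewrite ?normrN// linearN -(ltr0_norm fx0).
Qed.

Lemma dual_of_linear (f : X -> R^o) : linear f -> (forall x, f x <= `|x|) ->
  exists2 phi : dual X, phi =1 f & `|phi| <= 1.
Proof.
move=> lf fx.
have fc : continuous f.
  apply: (@linear_le_continuous _ _ _ f 1) => // x.
  rewrite mul1r ler_norml fx andbT lerNl.
  have := lf (-1) x 0; have := lf (-1) 0 0; have := fx (- x).
  by rewrite !scaleN1r !addr0 oppr0 normrN; lra.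
have fP : f \in @dual_pred R X by rewrite inE.
by exists (Dual fP) => //; apply/dual_ballP.
Qed.

Lemma norming_functional x : exists2 f : dual X, `|f| <= 1 & f x = `|x|.
Proof.
have [|f [lf fn fx]] := @hahn_banach R X (fun z => `|z|) x.
  by split=> [y z|a z a0]; rewrite ?ler_normD// normrZ gtr0_norm.
have [phi phif phi1] := dual_of_linear lf fn.
by exists phi; rewrite // phif.
Qed.

(** The distance to [G] is sublinear.  A linear functional below it that touches
    it at [y] vanishes on [G], and is positive at [y] because [G] is closed. *)
Lemma separating_functional (G : set X) y :
  submod_closed [in G] -> closed G -> ~ G y ->
  exists2 f : dual X, forall g, G g -> f g = 0 & f y != 0.
Proof.
move=> Gs Gc Gy; have /submod_closedP[G0 GD] := Gs.
pose Q := [set (fun x => `|x - g|) | g in G].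
have Qlb x : has_lbound [set m x | m in Q].
  by exists 0 => _ [_ [g _ <-] <-].
pose q x := inf [set m x | m in Q].
have qle x g : G g -> q x <= `|x - g|.
  by move=> Gg; apply: ge_inf => //; exists (fun x => `|x - g|) => //; exists g.
have qs : sublinear q.
  apply: sublinear_inf => //.
  - by exists (fun x => `|x - 0|); exists 0.
  - move=> _ _ u v [g Gg <-] [h Gh <-]; exists (fun x => `|x - (g + h)|).
      by exists (g + h) => //; rewrite -[g]scale1r; exact: GD.
    by rewrite opprD addrACA ler_normD.
  - move=> _ a u [g Gg <-] a0; exists (fun x => `|x - a *: g|).
      by exists (a *: g) => //; exact: submod_closedZ.
    by rewrite -scalerBr normrZ gtr0_norm.
have [f [lf fq fy]] := hahn_banach y qs.
have fn x : f x <= `|x|.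
  by apply: le_trans (fq x) _; have := qle x 0 G0; rewrite subr0.
have [phi phif _] := dual_of_linear lf fn.
have phi0 g : G g -> phi g <= 0.
  move=> Gg; rewrite phif; apply: le_trans (fq g) _.
  by have := qle g g Gg; rewrite subrr normr0.
exists phi.
  move=> g Gg; apply/le_anti; rewrite phi0//= -oppr_le0 -linearN phi0//.
  by rewrite -scaleN1r; exact: submod_closedZ.
have : open (~` G) by exact: closed_openC.
rewrite openE => /(_ y Gy); rewrite /interior => /nbhs_ballP[e/= e0 eG].
rewrite phif fy gt_eqF//; apply: lt_le_trans e0 _.
apply: lb_le_inf; first by exists `|y - 0|, (fun x => `|x - 0|) => //; exists 0.
move=> _ [_ [g Gg <-] <-]; rewrite leNgt; apply/negP => yg.
by have := eG g; rewrite -ball_normE/= => /(_ yg).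
Qed.

End functionals.

Record contraction {R : realType} (X Y : normedModType R) := Contraction {
  contraction_fun :> X -> Y ;
  contraction_linear : linear contraction_fun ;
  contraction_le : forall x, `|contraction_fun x| <= `|x| }.

HB.instance Definition _ (R : realType) (X Y : normedModType R)
    (T : contraction X Y) :=
  GRing.isLinear.Build R X Y *:%R T (contraction_linear T).

Section adjoint.
Context {R : realType} {X Y : normedModType R} (T : contraction X Y).

Lemma contraction_continuous : continuous T.
Proof.
apply: (@linear_le_continuous _ _ _ T 1); first exact: contraction_linear.
by move=> x; rewrite mul1r; exact: contraction_le.
Qed.

Let adjoint_subproof (g : dual Y) : (g \o T : X -> R^o) \in @dual_pred R X.
Proof.
rewrite inE; split; first by move=> a x y; rewrite /= !linearP.
move=> x; apply: continuous_comp; first exact: contraction_continuous.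
exact: dual_continuous.
Qed.

Definition adjoint_fun (g : dual Y) : dual X := Dual (adjoint_subproof g).

Let adjoint_linear : linear adjoint_fun.
Proof. by move=> a f g; apply/val_inj/funext. Qed.

Let adjoint_le (g : dual Y) : `|adjoint_fun g| <= `|g|.
Proof.
apply/dual_norm_leP => // x; apply: le_trans (dual_norm_apply g (T x)) _.
by rewrite ler_wpM2l// contraction_le.
Qed.

(** The adjoint is packed as a contraction so that it can be iterated: the
    second adjoint acts between the biduals. *)
Definition adjoint : contraction (dual Y) (dual X) :=
  Contraction adjoint_linear adjoint_le.

Lemma adjointE (g : dual Y) x : adjoint g x = g (T x). Proof. by []. Qed.

End adjoint.

Arguments adjoint {R X Y} T : simpl never.

Section norming.
Context {R : realType} {X : completeNormedModType R}.
Implicit Types (F : set (dual X)) (f : dual X).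

Lemma norming_unit_ballP F :
  norming_set (unit_ball F) <->
  forall (x : X) (e : R), 0 < e ->
    exists f, [/\ F f, `|f| <= 1 & `|x| - e <= f x].
Proof.
split=> [[_ Fn] x e e0|Fn].
  have : ((`|x| - e)%:E < ereal_sup [set (f x)%:E | f in unit_ball F])%E.
    by rewrite -Fn lte_fin ltrBlDr ltrDl.
  move=> /ereal_sup_gt[_ [f [Ff f1] <-]]; rewrite lte_fin => /ltW fx.
  by exists f.
split; first by move=> f [].
move=> x; apply/eqP; rewrite eq_le; apply/andP; split.
  apply/lee_addgt0Pr => e e0; have [f [Ff f1 fx]] := Fn x e e0.
  rewrite -leeBlDr// -EFinB; apply: (@le_trans _ _ (f x)%:E).
    by rewrite lee_fin.
  by apply: ereal_sup_ubound; exists f.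
apply: ge_ereal_sup => _ [f [_ f1] <-]; rewrite lee_fin.
by move/dual_ballP : f1; exact.
Qed.

(** A functional that slightly exceeds the unit ball is rescaled into it, at a
    small cost on its value at [x]. *)
Lemma norming_unit_ball_approx F : submod_closed [in F] ->
  (forall (x : X) (e : R), `|x| = 1 -> 0 < e -> e < 1 ->
    exists f, [/\ F f, `|f| <= 1 + e & 1 - e <= f x]) ->
  norming_set (unit_ball F).
Proof.
move=> Fs Fn; apply/norming_unit_ballP => x e e0.
have /submod_closedP[F0 _] := Fs.
have [->|x0] := eqVneq x 0.
  by exists 0; split; rewrite ?normr0 ?ler01 ?linear0// sub0r oppr_le0 ltW.
have nx0 : 0 < `|x| by rewrite normr_gt0.
pose d := Num.min (e / (2 * `|x|)) 2^-1.
have d0 : 0 < d by rewrite lt_min invr_gt0 ltr0n andbT divr_gt0// mulr_gt0.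
have d1 : d < 1 by rewrite gt_min; apply/orP; right; lra.
have de : 2 * d * `|x| <= e.
  have : d <= e / (2 * `|x|) by rewrite ge_min lexx.
  by rewrite ler_pdivlMr ?mulr_gt0//; lra.
have nx1 : `| `|x|^-1 *: x | = 1.
  by rewrite normrZ normfV normr_id mulVf// gt_eqF.
have [f [Ff f1 fx]] := Fn _ d nx1 d0 d1.
have d10 : 0 < 1 + d by lra.
exists ((1 + d)^-1 *: f); split; first exact: submod_closedZ.
  by rewrite normrZ normfV (gtr0_norm d10) ler_pdivrMl// mulr1.
rewrite dual_scaleE ler_pdivlMl//.
have {fx} : (1 - d) * `|x| <= f x.
  by move: fx; rewrite dualZ mulrC ler_pdivlMr.
apply: le_trans.
have : 0 < d * e by rewrite mulr_gt0.
nra.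
Qed.

End norming.

(** * Coordinates of an l_p-sum *)

Section coordinates.
Context {R : realType} {Gamma : choiceType}.
Context {X : Gamma -> completeNormedModType R} {p : R} {p1 : 1 < p}.
Local Notation lpsum := (lpsum X p1).
Implicit Types (A : set Gamma) (a : Gamma) (x y : lpsum).

Let p0 : 0 < p. Proof. exact: lt_trans p1. Qed.

Lemma lpmass_normE x : lpmass p x = (`|x| `^ p)%:E.
Proof. exact: lpmassE. Qed.

Lemma lpmassD_disjoint (x y : forall a, X a) :
  (forall a, x a = 0 \/ y a = 0) ->
  lpmass p (fun a => x a + y a) = (lpmass p x + lpmass p y)%E.
Proof.
move=> xy; rewrite /lpmass -esumD; [|by move=> a _; rewrite lee_fin powR_ge0..].
apply: eq_esum => a _; rewrite -EFinD.
by case: (xy a) => ->; rewrite normr0 powR0 ?gt_eqF// ?add0r ?addr0.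
Qed.

Lemma lpsum_normD_disjoint x y : (forall a, x a = 0 \/ y a = 0) ->
  `|x + y| `^ p = `|x| `^ p + `|y| `^ p.
Proof.
move=> xy; apply: EFin_inj; rewrite EFinD -!lpmass_normE.
exact: lpmassD_disjoint.
Qed.

Definition restrict_fun A (x : forall a, X a) : forall a, X a :=
  fun a => if a \in A then x a else 0.

Lemma restrict_mass A (x : forall a, X a) :
  lpmass p (restrict_fun A x) = (\esum_(a in A) (`|x a| `^ p)%:E)%E.
Proof.
rewrite [RHS]esum_mkcond; apply: eq_esum => a _; rewrite /restrict_fun.
by case: ifP => // _; rewrite normr0 powR0// gt_eqF.
Qed.

Let restrict_lty A x : (lpmass p (restrict_fun A x) < +oo)%E.
Proof.
apply: le_lt_trans (lpfun_lty x); rewrite restrict_mass esum_mkcond.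
by apply: le_esum => a _; case: ifP => // _; rewrite lee_fin powR_ge0.
Qed.

Let restrict_lpsum A x : lpsum := LpSum p1 (restrict_lty A x).

Let restrict_linear A : linear (restrict_lpsum A).
Proof.
move=> k x y; apply: lpsumP => a /=; rewrite /restrict_fun /=.
by case: ifP => // _; rewrite scaler0 addr0.
Qed.

Let restrict_le A x : `|restrict_lpsum A x| <= `|x|.
Proof.
rewrite -[`|restrict_lpsum A x|]/(lpnorm _) lpnorm_le ?normr_ge0//.
rewrite -lpmass_normE restrict_mass esum_mkcond.
by apply: le_esum => a _; case: ifP => // _; rewrite lee_fin powR_ge0.
Qed.

Definition restrict A : contraction lpsum lpsum :=
  Contraction (restrict_linear A) (@restrict_le A).

Lemma restrictE A x a : restrict A x a = if a \in A then x a else 0.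
Proof. by []. Qed.

Lemma restrict_setC A x : restrict A x + restrict (~` A) x = x.
Proof.
apply: lpsumP => a; rewrite -[LHS]/(restrict A x a + restrict (~` A) x a).
by rewrite !restrictE in_setC; case: (a \in A); rewrite ?addr0 ?add0r.
Qed.

Lemma restrict_disjoint A x y a : restrict A x a = 0 \/ restrict (~` A) y a = 0.
Proof.
by rewrite !restrictE in_setC; case: (a \in A); [right|left].
Qed.

Lemma restrict_norm_setC A x :
  `|x| `^ p = `|restrict A x| `^ p + `|restrict (~` A) x| `^ p.
Proof.
rewrite -lpsum_normD_disjoint ?restrict_setC// => a.
exact: restrict_disjoint.
Qed.

(** The mass of [x] is the supremum of its finite subsums, so some finite set
    carries all of it but [e `^ p]. *)
Lemma restrict_finite_adherent x (e : R) : 0 < e ->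
  exists2 s : seq Gamma, uniq s & `|restrict (~` [set` s]) x| < e.
Proof.
move=> e0; have ep0 : 0 < e `^ p by rewrite powR_gt0.
have : ((`|x| `^ p - e `^ p)%:E < lpmass p x)%E.
  by rewrite lpmass_normE lte_fin gtrBl.
move=> /ereal_sup_gt[_ [J [finJ _] <-]].
have /finite_seqP[s sJ] := finJ.
rewrite -esum_fset//.
rewrite -restrict_mass (lpmass_normE (restrict J x)) lte_fin.
rewrite (restrict_norm_setC J) => xe; exists (undup s); first exact: undup_uniq.
have -> : [set` undup s] = J.
  by rewrite sJ; apply/seteqP; split=> a /=; rewrite mem_undup.
rewrite ltNge; apply/negP => /(ge0_ler_powR (ltW p0)).
rewrite !nnegrE (ltW e0) normr_ge0 => /(_ isT isT); lra.
Qed.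

Let proj_linear a : linear (fun x : lpsum => x a).
Proof. by []. Qed.

Definition proj a : contraction lpsum (X a) :=
  Contraction (@proj_linear a) (fun x => lpnorm_coord x a).

Definition inj_fun a (v : X a) : forall b, X b :=
  dfwith (fun b => 0 : X b) a v.

Lemma inj_fun_in a (v : X a) : inj_fun v a = v.
Proof. exact: dfwithin. Qed.

Lemma inj_fun_out a b (v : X a) : a != b -> inj_fun v b = 0.
Proof. exact: dfwithout. Qed.

Lemma inj_mass a (v : X a) :
  lpmass p (inj_fun v) = (`|v| `^ p)%:E.
Proof.
have v0 : (0 <= (`|v| `^ p)%:E)%E by rewrite lee_fin powR_ge0.
transitivity (\esum_(b in [set a])
    (`|inj_fun v b| `^ p)%:E)%E; last first.
  by rewrite esum_set1 inj_fun_in.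
rewrite [RHS]esum_mkcond; apply: eq_esum => b _; rewrite in_set1.
have [->|ba] := eqVneq b a; first by rewrite inj_fun_in.
by rewrite inj_fun_out 1?eq_sym// normr0 powR0// gt_eqF.
Qed.

Let inj_lty a (v : X a) : (lpmass p (inj_fun v) < +oo)%E.
Proof. by rewrite inj_mass ltry. Qed.

Let inj_lpsum a (v : X a) : lpsum := LpSum p1 (inj_lty v).

Let inj_linear a : linear (@inj_lpsum a).
Proof.
move=> k u v; apply: lpsumP => b /=.
have [<-|ba] := eqVneq a b; first by rewrite !inj_fun_in.
by rewrite !inj_fun_out// scaler0 addr0.
Qed.

Let inj_le a (v : X a) : `|inj_lpsum v| <= `|v|.
Proof.
by rewrite -[`|inj_lpsum v|]/(lpnorm _) lpnorm_le// inj_mass.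
Qed.

Definition inj a : contraction (X a) lpsum :=
  Contraction (@inj_linear a) (@inj_le a).

Lemma inj_in a (v : X a) : inj a v a = v.
Proof. exact: inj_fun_in. Qed.

Lemma inj_out a b (v : X a) : a != b -> inj a v b = 0.
Proof. exact: inj_fun_out. Qed.

Lemma injK a (v : X a) : proj a (inj a v) = v.
Proof. exact: inj_in. Qed.

Lemma inj_norm a (v : X a) : `|inj a v| = `|v|.
Proof.
apply/le_anti; rewrite contraction_le/=.
by have := contraction_le (proj a) (inj a v); rewrite injK.
Qed.

Lemma inj_proj a x : inj a (proj a x) = restrict [set a] x.
Proof.
apply: lpsumP => b; rewrite restrictE in_set1.
have [->|ba] := eqVneq b a; first by rewrite inj_in.
by rewrite inj_out// eq_sym.
Qed.

Lemma restrict_cons a (s : seq Gamma) x : a \notin s ->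
  restrict [set` a :: s] x = inj a (proj a x) + restrict [set` s] x.
Proof.
move=> as_; rewrite inj_proj; apply: lpsumP => b.
rewrite -[RHS]/(restrict [set a] x b + restrict [set` s] x b) !restrictE.
rewrite in_set1 !mem_setE inE.
have [->|ba] := eqVneq b a; first by rewrite (negbTE as_) addr0.
by rewrite add0r.
Qed.

End coordinates.

(** * Almost norming functionals *)

Section almost_norming.
Context {R : realType} {Gamma : choiceType}.
Context {X : Gamma -> completeNormedModType R} {p : R} {p1 : 1 < p}.
Local Notation lpsum := (lpsum X p1).

(** For [u] supported in [A] and [v] off [A], both in the unit ball, the norm of
    [u + s *: v] is at most [(1 + s `^ p) `^ p^-1], hence at most [1 + s `^ p].
    If [g u] is at least [1 - s `^ p], then [s * g v] is at most
    [2 * s `^ p], so that [g v] is at most [2 * s `^ (p - 1)], which is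
    arbitrarily small since [1 < p]. *)
Lemma almost_norming_small (e : R) : 0 < e -> exists2 eta : R, 0 < eta &
  forall (g : dual lpsum) (A : set Gamma) (x : lpsum),
    `|g| <= 1 -> `|x| <= 1 -> 1 - eta <= g (restrict A x) ->
    `|adjoint (restrict (~` A)) g| <= e.
Proof.
move=> e0; pose s := (e / 2) `^ (p - 1)^-1.
have s0 : 0 < s by rewrite powR_gt0// divr_gt0.
have se : s `^ (p - 1) = e / 2.
  by rewrite /s -powRrM mulVf ?powRr1 ?gt_eqF ?subr_gt0// ltW ?divr_gt0.
have p0 : 0 < p := lt_trans ltr01 p1.
exists (s `^ p); first by rewrite powR_gt0.
move=> g A x g1 x1 gx.
(* it is enough to bound [g] on the part of the unit ball living off [A] *)
have small (y : lpsum) : `|y| <= 1 -> g (restrict (~` A) y) <= e.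
  move=> y1; pose u := restrict A x; pose v := restrict (~` A) y.
  have u1 : `|u| <= 1 := le_trans (contraction_le _ _) x1.
  have v1 : `|v| <= 1 := le_trans (contraction_le _ _) y1.
  have sp0 : 0 <= s `^ p := powR_ge0 _ _.
  have uv : `|u + s *: v| <= 1 + s `^ p.
    rewrite leNgt; apply/negP => lt_uv.
    have {lt_uv} : (1 + s `^ p) `^ p < `|u + s *: v| `^ p.
      by apply: gt0_ltr_powR; rewrite // nnegrE ?addr_ge0.
    apply/negP; rewrite -leNgt lpsum_normD_disjoint; last first.
      move=> a; have [ua|va] := restrict_disjoint A x y a; [by left|right].
      by rewrite -[LHS]/(s *: v a) va scaler0.
    apply: (@le_trans _ _ (1 + s `^ p)).
      have one_p : 1 `^ p = 1 :> R by rewrite powR1.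
      apply: lerD; first by rewrite -one_p ge0_ler_powR ?nnegrE ?(ltW p0).
      rewrite normrZ gtr0_norm//.
      rewrite ge0_ler_powR ?nnegrE ?mulr_ge0 ?(ltW p0) ?(ltW s0)//.
      by rewrite ler_piMr// (ltW s0).
    rewrite -[leLHS]powRr1 ?addr_ge0//; apply: ler_powR; last exact: ltW.
    by rewrite lerDl.
  have : g u + s * g v <= 1 + s `^ p.
    rewrite -dualZ -dualD.
    by move/dual_ballP : g1 => /(_ (u + s *: v)) /le_trans; apply.
  move=> guv; have : s * g v <= s * e.
    have -> : s * e = s `^ p + s `^ p.
      by rewrite -(mulr_powRB1 (ltW s0) p0) se; lra.
    by move: gx; rewrite -/u => gx; lra.
  by rewrite ler_pM2l.
apply: dual_norm_le => y y1; rewrite adjointE ler_norml small// andbT lerNl.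
by rewrite -!linearN; apply: small; rewrite normrN.
Qed.

End almost_norming.

(** * Passing to a summand and back *)

Section summands.
Context {R : realType} {Gamma : choiceType}.
Context {X : Gamma -> completeNormedModType R} {p : R} {p1 : 1 < p}.
Local Notation lpsum := (lpsum X p1).

Lemma adjoint_proj_inj a (g : dual lpsum) :
  adjoint (proj a) (adjoint (inj a) g) = adjoint (restrict [set a]) g.
Proof.
apply/val_inj/funext => x.
by rewrite -[RHS]/(g (restrict [set a] x)) -inj_proj.
Qed.

Lemma adjoint_inj_proj a (f : dual (X a)) :
  adjoint (@inj _ _ X p p1 a) (adjoint (proj a) f) = f.
Proof.
by apply/val_inj/funext => v; rewrite -[LHS]/(f (proj a (inj a v))) injK.
Qed.

Lemma adjoint_restrict_setC (A : set Gamma) (g : dual lpsum) :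
  adjoint (restrict A) g + adjoint (restrict (~` A)) g = g.
Proof.
apply/val_inj/funext => x.
rewrite -[LHS]/(g (restrict A x) + g (restrict (~` A) x)).
by rewrite -dualD restrict_setC.
Qed.

(** For [x] in the sum take a functional [phi] attaining the norm of [x], and
    replace its coordinate [phia] at [a] by an element [h] of [F] that is at
    least as large at [x a] up to [e] and has no larger norm.  The norm of the
    result is still at most 1: its value at [y] is nearly bounded by the value
    of [phi] at the vector obtained from [y] by turning its coordinate at [a]
    into a direction where [phia] almost attains its norm. *)
Lemma norming_subspace_inj a (F : set (dual (X a))) : norming_subspace F ->
  norming_subspace (adjoint (@inj _ _ X p p1 a) @^-1` F).
Proof.
move=> [Fs Fc /norming_unit_ballP Fn]; split.
- exact: submod_closed_preimage.
- apply: preimage_closed => // g _; exact: contraction_continuous.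
apply/norming_unit_ballP => x e e0.
have [phi phi1 phix] := norming_functional x.
pose phia := adjoint (inj a) phi; pose c := `|phia|.
have c0 : 0 <= c by exact: normr_ge0.
have c1 : c <= 1 := le_trans (contraction_le _ _) phi1.
have [f [Ff f1 fx]] := Fn (x a) e e0.
pose h := c *: f.
have hx : phia (x a) - e <= h (x a).
  apply: (@le_trans _ _ (c * `|x a| - e)).
    by rewrite lerD2r dual_apply_le.
  rewrite dual_scaleE; apply: (@le_trans _ _ (c * (`|x a| - e))).
    by rewrite mulrBr lerD2l lerN2 ler_piMl// ltW.
  by rewrite ler_wpM2l.
pose g := adjoint (restrict (~` [set a])) phi + adjoint (proj a) h.
have gE (y : lpsum) : g y = phi (restrict (~` [set a]) y) + h (y a) by [].
have phiE (y : lpsum) : phi y = phi (restrict (~` [set a]) y) + phia (y a).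
  rewrite /phia adjointE -dualD -[y a]/(proj a y) inj_proj addrC.
  by rewrite restrict_setC.
exists g; split.
- suff gh : adjoint (inj a) g = h.
    by rewrite -[_ g]/(F (adjoint (inj a) g)) gh; exact: submod_closedZ.
  apply/val_inj/funext => v.
  rewrite -[LHS]/(g (inj a v)) gE inj_in -[RHS]add0r; congr (_ + _).
  rewrite (_ : restrict _ _ = 0) ?linear0//; apply: lpsumP => b.
  rewrite restrictE in_setC in_set1.
  by have [//|ba] := eqVneq b a; rewrite inj_out// eq_sym.
- (* [w] is a vector at which [phia] nearly attains its norm, of norm at most
     that of [y a]: exchanging [y a] for it does not increase the norm of [y] *)
  apply/dual_ballP => y; apply/ler_addgt0Pr => d d0; rewrite gE.
  have [w w1 phiw] : exists2 w, `|w| <= `|y a| & h (y a) <= phia w + d.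
    have ya0 : 0 < `|y a| + 1 by rewrite ltr_wpDl.
    have [v v1 phiv] := dual_norm_adherent phia (divr_gt0 d0 ya0).
    exists (`|y a| *: v); first by rewrite normrZ normr_id ler_piMr.
    rewrite dualZ.
    have hy : h (y a) <= c * `|y a|.
      rewrite dual_scaleE ler_wpM2l//.
      by move/dual_ballP : f1; exact.
    have dy : d / (`|y a| + 1) * `|y a| <= d.
      by rewrite mulrAC ler_pdivrMr// ler_pM2l// lerDl.
    have := ler_wpM2l (normr_ge0 (y a)) (ltW phiv).
    by rewrite -/c mulrBr; lra.
  pose z := restrict (~` [set a]) y + inj a w.
  have zy : `|z| <= `|y|.
    have p0 : 0 < p := lt_trans ltr01 p1.
    rewrite leNgt; apply/negP => /(gt0_ltr_powR p0).
    rewrite !nnegrE !normr_ge0 => /(_ isT isT); apply/negP; rewrite -leNgt.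
    rewrite (restrict_norm_setC [set a] y) lpsum_normD_disjoint; last first.
      move=> b; rewrite restrictE in_setC in_set1.
      by have [->|ba] := eqVneq b a; [left|right; rewrite inj_out// eq_sym].
    rewrite addrC lerD2r -inj_proj !inj_norm.
    by rewrite ge0_ler_powR ?nnegrE// ltW.
  have phiz : phi z = phi (restrict (~` [set a]) y) + phia w.
    by rewrite dualD.
  move/dual_ballP : phi1 => /(_ z); lra.
- by rewrite -phix phiE gE -addrA lerD2l.
Qed.

(** Let [g] in [G] almost attain its norm at [inj a x].  By
    [almost_norming_small] it is close to its coordinate [ga] at [a], and [psi]
    vanishes at [g], so the coordinate of [psi] at [a] is small at [ga]: a small
    correction of [ga] falls into the kernel. *)
Lemma norming_subspace_kernel a (G : set (dual lpsum))
    (psi : dual (dual lpsum)) :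
  norming_subspace G -> (forall g, G g -> psi g = 0) ->
  adjoint (adjoint (proj a)) psi != 0 ->
  norming_subspace (adjoint (adjoint (proj a)) psi @^-1` [set 0]).
Proof.
move=> [Gs Gc /norming_unit_ballP Gn] psiG.
set z := adjoint (adjoint (proj a)) psi => z0.
have Ks : submod_closed [in z @^-1` [set 0]].
  apply: submod_closed_preimage; apply/submod_closedP; split=> // k u v -> ->.
  by rewrite scaler0 addr0.
split => //.
  apply: preimage_closed => [g _|]; first exact: dual_continuous.
  exact: closed_eq.
apply: norming_unit_ball_approx => // x e x1 e0 e1.
have [f zf] : exists f, z f != 0.
  apply: contrapT => /forallNP zf; case/negP : z0.
  apply/eqP/val_inj/funext => f.
  by apply: contrapT => /eqP; exact: zf.
pose C := `|psi| * (`|f| / `|z f|).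
have C0 : 0 <= C by rewrite mulr_ge0// divr_ge0.
pose d := e / 2 / (1 + C).
have d0 : 0 < d by rewrite !divr_gt0// ltr_pwDl.
have Cd : C * d <= e / 2.
  rewrite /d mulrC mulrAC ler_pdivrMr ?ltr_pwDl// ler_wpM2l ?lerDr//.
  by rewrite ltW// divr_gt0.
have [eta eta0 small] := @almost_norming_small _ _ X _ p1 d d0.
pose r := Num.min eta (e / 2).
have r0 : 0 < r by rewrite lt_min eta0 divr_gt0.
have [g [Gg g1 gx]] := Gn (inj a x) r r0.
move: gx; rewrite inj_norm x1 => gx.
pose ga := adjoint (inj a) g.
have ga1 : `|ga| <= 1 := le_trans (contraction_le _ _) g1.
have rest : `|adjoint (restrict (~` [set a])) g| <= d.
  apply: (small _ _ (inj a x)) => //; first by rewrite inj_norm x1.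
  rewrite -inj_proj injK; apply: le_trans gx.
  by rewrite lerD2l lerN2 ge_min lexx.
have zga : `|z ga| <= `|psi| * d.
  have -> : z ga = - psi (adjoint (restrict (~` [set a])) g).
    rewrite -[LHS]/(psi (adjoint (proj a) ga)) adjoint_proj_inj.
    apply/eqP; rewrite -addr_eq0 -dualD adjoint_restrict_setC.
    exact/eqP/psiG.
  rewrite normrN; apply: le_trans (dual_norm_apply _ _) _.
  by rewrite ler_wpM2l.
(* [ga] is moved into the kernel along [f] *)
pose k := (z ga / z f) *: f.
have kC : `|k| <= e / 2.
  have -> : `|k| = `|z ga| * (`|f| / `|z f|).
    by rewrite normrZ normrM normfV mulrAC mulrA.
  by apply: le_trans Cd; rewrite /C mulrAC ler_wpM2r// divr_ge0.
have kx : `|k x| <= e / 2.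
  by have := dual_norm_apply k x; rewrite x1 mulr1 => /le_trans; apply.
exists (ga - k); split.
- have zk : z k = z ga.
    by rewrite dualZ divfK.
  by rewrite -[_ (ga - k)]/(z (ga - k) = 0) dualB zk subrr.
- by apply: le_trans (ler_normB _ _) _; rewrite lerD//; lra.
- have -> : (ga - k) x = g (inj a x) - k x by [].
  have : r <= e / 2 by rewrite ge_min lexx orbT.
  move: kx; rewrite ler_norml => /andP[]; lra.
Qed.

(** The functionals with finitely many nonzero coordinates are dense: cutting a
    unit functional down to the support of a finitely supported vector at
    which it almost attains its norm changes it little, by
    [almost_norming_small]. *)
Lemma coordinates_total (psi : dual (dual lpsum)) :
  (forall a, adjoint (adjoint (proj a)) psi = 0) -> psi = 0.
Proof.
move=> psi0.
have psi_coord a f : psi (adjoint (proj a) f) = 0.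
  by rewrite -[LHS]/(adjoint (adjoint (proj a)) psi f) psi0.
have psi_finite (s : seq Gamma) (g : dual lpsum) :
    uniq s -> psi (adjoint (restrict [set` s]) g) = 0.
  elim: s => [|a s IHs].
    move=> _; rewrite (_ : adjoint _ g = 0) ?linear0//.
    apply/val_inj/funext => x; rewrite -[LHS]/(g (restrict _ x)).
    by rewrite (_ : restrict _ x = 0) ?linear0//; apply: lpsumP => b;
      rewrite restrictE mem_setE.
  rewrite cons_uniq => /andP[as_ us].
  rewrite (_ : adjoint _ g = adjoint (proj a) (adjoint (inj a) g) +
    adjoint (restrict [set` s]) g).
    by rewrite dualD psi_coord IHs// addr0.
  apply/val_inj/funext => x; rewrite -[LHS]/(g (restrict _ x)).
  by rewrite restrict_cons// dualD.
have psi_unit (g : dual lpsum) : `|g| = 1 -> psi g = 0.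
  move=> g1; apply/normr0_eq0/le_anti; rewrite normr_ge0 andbT.
  apply/ler_addgt0Pr => e e0; rewrite add0r.
  have n0 : 0 < `|psi| + 1 by rewrite ltr_wpDl.
  have [eta eta0 small] := @almost_norming_small _ _ X _ p1 _ (divr_gt0 e0 n0).
  have eta20 : 0 < eta / 2 by rewrite divr_gt0.
  have [x x1 gx] := dual_norm_adherent g eta20.
  have [s us xs] := restrict_finite_adherent x eta20.
  have gxs : 1 - eta <= g (restrict [set` s] x).
    have := dual_apply_le g (restrict (~` [set` s]) x).
    have : g x = g (restrict [set` s] x) + g (restrict (~` [set` s]) x).
      by rewrite -dualD restrict_setC.
    move: gx; rewrite g1 mul1r; lra.
  have rest := small g _ x _ x1 gxs.
  rewrite -(adjoint_restrict_setC [set` s] g) dualD psi_finite// add0r.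
  apply: le_trans (dual_norm_apply _ _) _.
  apply: le_trans (ler_wpM2l (normr_ge0 _) (rest _)) _; first by rewrite g1.
  by rewrite mulrCA ler_piMr ?(ltW e0)// ler_pdivrMr// mul1r lerDl.
apply/val_inj/funext => g; rewrite -[LHS]/(psi g) -[RHS]/(0 : R).
have [->|g0] := eqVneq g 0; first exact: linear0.
have ng0 : `|g| != 0 by rewrite normr_eq0.
have : psi (`|g|^-1 *: g) = 0.
  by apply: psi_unit; rewrite normrZ normfV normr_id mulVf.
by rewrite dualZ => /eqP; rewrite mulf_eq0 invr_eq0 (negbTE ng0) => /eqP.
Qed.

End summands.

Arguments adjoint_inj_proj {R Gamma X p} p1 {a} f.

Local Close Scope classical_set_scope.

Theorem theorem10 (R : realType) (Gamma : choiceType)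
    (X : Gamma -> completeNormedModType R) (p : R) (p1 : 1 < p) :
  nicely_smooth (lpsum X p1) <-> forall a : Gamma, nicely_smooth (X a).
Proof.
split=> [Xns a [F [Fn FT]]|Xns [G [Gn GT]]].
- apply: Xns; exists (adjoint (inj a) @^-1` F)%classic; split.
    exact: norming_subspace_inj.
  split=> // TF; apply: FT.2 => f _.
  rewrite -(adjoint_inj_proj p1 f).
  exact: (TF (adjoint (proj a) f) I).
- apply: GT.2 => g _; apply: contrapT => Gg.
  have [Gs Gc _] := Gn.
  have [psi psiG] := separating_functional Gs Gc Gg.
  rewrite (_ : psi = 0) ?eqxx//; apply: coordinates_total => a.
  apply/eqP/negPn/negP => z0; apply: (Xns a).
  exists (adjoint (adjoint (proj a)) psi @^-1` [set 0])%classic; split.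
    exact: norming_subspace_kernel Gn psiG z0.
  split=> // Tz; case/negP : z0; apply/eqP/val_inj/funext => f.
  exact: Tz.
Qed.
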